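(* For every regular bipartite graph $G=(V_1\cup V_2,E)$ with $|V_1|=|V_2|$ we have $$\tfrac14\,\widehat{\mathrm{las}_{\mathrm{bal}}}(G)=\tfrac12\sqrt{\widehat{g_{\mathrm{bal}}}(G)}=\tfrac14\,\widehat{\vartheta_{\mathrm{bal}}}(G)=\widehat h(G).$$
   Context: Graphs are finite and simple; $G=(V=V_1\cup V_2,E)$ is bipartite with given bipartition and adjacency matrix $A_G$. $\mathcal S^{|V|}$ is the set of real symmetric matrices indexed by $V$; $\langle X,Y\rangle=\mathrm{Tr}(XY)$; $I$, $J$, $e$ are the identity matrix, all-ones matrix and all-ones vector of size $|V|$; $\mathrm{Diag}(x)$ is the diagonal matrix with diagonal $x$. Let $f=\chi^{V_1}-\chi^{V_2}$ (value $1$ on $V_1$, $-1$ on $V_2$), and let $C\in\mathcal S^{|V|}$ have entries $\frac12$ at positions $(i,j)$ with $i,j$ on different sides of the bipartition, and $0$ elsewhere. Define $$\widehat{\mathrm{las}_{\mathrm{bal}}}(G)=\max_{X\in\mathcal S^{|V|},\,x\in\mathbb R^{|V|}}\Big\{\langle I,X\rangle:\begin{pmatrix}1&x^T\\ x&X\end{pmatrix}\succeq0,\ \mathrm{Tr}(X)=e^Tx,\ \langle A_G,X\rangle=0,\ \langle ff^T,X\rangle=0,\ \langle\mathrm{Diag}(f),X\rangle=0\Big\},$$ $$\widehat{g_{\mathrm{bal}}}(G)=\max_{X\in\mathcal S^{|V|},\,x\in\mathbb R^{|V|}}\Big\{\langle C,X\rangle:\begin{pmatrix}1&x^T\\ x&X\end{pmatrix}\succeq0,\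 \mathrm{Tr}(X)=e^Tx,\ \langle A_G,X\rangle=0,\ \langle ff^T,X\rangle=0,\ \langle\mathrm{Diag}(f),X\rangle=0\Big\},$$ $$\widehat{\vartheta_{\mathrm{bal}}}(G)=\max_{X\in\mathcal S^{|V|}}\{\langle J,X\rangle: X\succeq0,\ \mathrm{Tr}(X)=1,\ \langle A_G,X\rangle=0,\ \langle ff^T,X\rangle=0,\ \langle\mathrm{Diag}(f),X\rangle=0\},$$ $$\widehat h(G)=\min_{\lambda,t\in\mathbb R}\{\lambda:\ \lambda I+tA_G-C\succeq0\}.$$ Convention: the value of a maximization program with no feasible solution is $0$ (relevant only for $G=K_{1,1}$ here). *)

(* Defs.v *)
From mathcomp Require Import all_boot all_order all_algebra.

Set Implicit Arguments.
Unset Strict Implicit.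
Unset Printing Implicit Defensive.

Record bigraph (V : finType) := Bigraph {
  adj : rel V;
  part1 : {set V};
  part2 : {set V};
  adj_sym : symmetric adj;
  adj_irr : irreflexive adj;
  part_cover : part1 :|: part2 = [set: V];
  part_disjoint : [disjoint part1 & part2];
  adj_bip : forall u v, adj u v ->
    (u \in part1) && (v \in part2) || (u \in part2) && (v \in part1)
}.

Definition regular (V : finType) (G : bigraph V) : Prop :=
  exists d : nat, forall v : V, #|[set w | adj G v w]| = d.

(* Imported only here: [set _ | _], [set: _] and [disjoint _ & _] above are the
   finite-set notations. *)
From mathcomp Require Import all_classical all_reals.

Import Order.TTheory GRing.Theory Num.Theory.
Local Open Scope classical_set_scope.
Local Open Scope ring_scope.

(* Vectors and matrices indexed by V are indexed by 'I_#|V|, through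
   enum_val : 'I_#|V| -> V. *)
Section Matrices.
Variables (R : realType) (V : finType) (G : bigraph V).

Definition adjmx : 'M[R]_#|V| :=
  \matrix_(i, j) (adj G (enum_val i) (enum_val j))%:R.

Definition crossmx : 'M[R]_#|V| :=
  \matrix_(i, j) (if (enum_val i \in part1 G) && (enum_val j \in part2 G)
                  || (enum_val i \in part2 G) && (enum_val j \in part1 G)
                  then 2^-1 else 0).

Definition sidevec : 'cV[R]_#|V| :=
  \col_i ((enum_val i \in part1 G)%:R - (enum_val i \in part2 G)%:R).

Definition psd (n : nat) (M : 'M[R]_n) : Prop :=
  M \is symmetricmx /\ forall v : 'cV[R]_n, 0 <= (v^T *m M *m v) 0 0.

Definition mxdot (n : nat) (X Y : 'M[R]_n) : R := \tr (X *m Y).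

Definition balanced_constraints (X : 'M[R]_#|V|) : Prop :=
  [/\ mxdot adjmx X = 0,
      mxdot (sidevec *m sidevec^T) X = 0
    & mxdot (diag_mx sidevec^T) X = 0].

Definition lasserre_feasible (X : 'M[R]_#|V|) (x : 'cV[R]_#|V|) : Prop :=
  [/\ X \is symmetricmx,
      psd (block_mx 1%:M x^T x X),
      \tr X = ((const_mx 1 : 'cV[R]_#|V|)^T *m x) 0 0
    & balanced_constraints X].

Definition theta_feasible (X : 'M[R]_#|V|) : Prop :=
  [/\ X \is symmetricmx, psd X, \tr X = 1 & balanced_constraints X].

(* [is_max_value S v]: v is the value of the program of maximizing over the
   set S of attained objective values; an infeasible program has value 0. *)
Definition is_max_value (S : set R) (v : R) : Prop :=
  (S v /\ ubound S v) \/ (S = set0 /\ v = 0).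

Definition is_min_value (S : set R) (v : R) : Prop := S v /\ lbound S v.

Definition is_las_bal_hat : R -> Prop :=
  is_max_value [set v | exists X x, lasserre_feasible X x /\ v = mxdot 1%:M X].

Definition is_g_bal_hat : R -> Prop :=
  is_max_value [set v | exists X x, lasserre_feasible X x /\ v = mxdot crossmx X].

Definition is_theta_bal_hat : R -> Prop :=
  is_max_value
    [set v | exists X, theta_feasible X /\ v = mxdot (const_mx 1) X].

Definition is_h_hat : R -> Prop :=
  is_min_value
    [set lambda | exists t : R, psd (lambda%:M + t *: adjmx - crossmx)].

End Matrices.

(* Main.v *)
Require Import Defs.
From mathcomp Require Import all_boot all_order all_algebra.
From mathcomp Require Import all_classical all_reals.
From mathcomp Require Import ring lra.

Set Implicit Arguments.
Unset Strict Implicit.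
Unset Printing Implicit Defensive.

Import Order.TTheory GRing.Theory Num.Theory.
Local Open Scope ring_scope.

(** All four quantities are governed by one number, the optimal [lam] of the
minimization program: the maxima are [4 * lam], [4 * lam ^+ 2] and [4 * lam].
Write [n] for the number of vertices, [d] for the degree, [A] for the
adjacency matrix, [e] for the all-ones vector, [f] for the side vector and
[J = e e^T].

Upper bounds are semidefinite duality. Since [C = (J - f f^T) / 4], every
positive semidefinite [X] orthogonal to [A] and [f f^T] satisfies
[<J, X> / 4 = <C, X> = <C - t A, X>] for every [t], hence
[<J, X> / 4 <= lam * \tr X] as soon as [lam I + t A - C] is positive
semidefinite (lemma [weak_duality]). With [\tr X = 1] this bounds the theta
value by [4 * lam]. For the two bordered programs, positivity of the bordered
matrix on the vector [(- e^T x, e)] adds [(\tr X) ^+ 2 <= <J, X>], so that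
[\tr X <= 4 * lam] and then [<C, X> <= 4 * lam ^+ 2].

For attainment (lemma [optimal_pair]), regularity and the bipartition make [e]
and [f] eigenvectors of [A] for [d] and [- d]; balancedness makes them
orthogonal. Removing both from [- A] leaves the deflated matrix
[N = (d / n) (e e^T - f f^T) - A], which kills [e] and [f]. Let [mu >= 0] be
its largest eigenvalue and [z] an eigenvector. If [d > 0], the choice
[t = n / (4 (d + mu))], [lam = t * mu] makes [lam I + t A - C] positive
semidefinite. On the primal side, for [mu > 0] the vector [z] is orthogonal to
[e] and [f] and [A z = - mu z], so that some combination
[X = c ^+ 2 e e^T + g z z^T] is orthogonal to [A]; bordered by [x = c e] it is
feasible, with [\tr X = 4 * lam] and [<J, X> = 16 * lam ^+ 2], and meets the
upper bounds. Dividing it by its trace solves the theta program. For [mu = 0]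
one gets [lam = 0] and [X = 0] does; the theta program is then either
infeasible or has only the value 0. For [d = 0], [t = 0] and [X = J] do.

Two facts of linear algebra support this: a real symmetric matrix has a
largest eigenvalue that bounds its quadratic form ([largest_eigenvalue]), and
the trace product of positive semidefinite matrices is nonnegative
([mxdot_psd_ge0]). *)

(** * Bilinear forms given by matrices *)

Section BilinearForms.
Variable R : realType.

Definition bil n (M : 'M[R]_n) (u v : 'cV[R]_n) : R := (u^T *m M *m v) 0 0.
Definition dot n (u v : 'cV[R]_n) : R := (u^T *m v) 0 0.

Lemma symmetricmxE n (M : 'M[R]_n) : (M \is symmetricmx) <-> M^T = M.
Proof.
split=> [/is_hermitianmxP|MT]; last apply/is_hermitianmxP;
by rewrite expr0 scale1r map_mx_id // => ->; rewrite trmxK.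
Qed.

Lemma dotE n (u v : 'cV[R]_n) : dot u v = \sum_i u i 0 * v i 0.
Proof. by rewrite /dot mxE; apply: eq_bigr => i _; rewrite mxE. Qed.

Lemma bil_dot n (M : 'M[R]_n) u v : bil M u v = dot u (M *m v).
Proof. by rewrite /bil /dot mulmxA. Qed.

Lemma bilE n (M : 'M[R]_n) u v :
  bil M u v = \sum_i \sum_j u i 0 * M i j * v j 0.
Proof.
rewrite bil_dot dotE; apply: eq_bigr => i _; rewrite mxE big_distrr /=.
by apply: eq_bigr => j _; rewrite mulrA.
Qed.

Lemma dotC n (u v : 'cV[R]_n) : dot u v = dot v u.
Proof. by rewrite !dotE; apply: eq_bigr => i _; rewrite mulrC. Qed.

Lemma dotZr n a (u v : 'cV[R]_n) : dot u (a *: v) = a * dot u v.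
Proof. by rewrite /dot -scalemxAr mxE. Qed.

Lemma dotZl n a (u v : 'cV[R]_n) : dot (a *: u) v = a * dot u v.
Proof. by rewrite dotC dotZr dotC. Qed.

Lemma dot0r n (u : 'cV[R]_n) : dot u 0 = 0.
Proof. by rewrite /dot mulmx0 mxE. Qed.

Lemma bilC n (M : 'M[R]_n) u v : M^T = M -> bil M u v = bil M v u.
Proof.
move=> MT; rewrite /bil -[in RHS]MT.
have -> : v^T *m M^T *m u = (u^T *m M *m v)^T.
  by rewrite !trmx_mul trmxK mulmxA.
by rewrite [in RHS]mxE.
Qed.

Lemma bil_dotl n (M : 'M[R]_n) u v : M^T = M -> bil M u v = dot (M *m u) v.
Proof. by move=> MT; rewrite bilC // bil_dot dotC. Qed.

Lemma bilDm n (M N : 'M[R]_n) u v : bil (M + N) u v = bil M u v + bil N u v.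
Proof. by rewrite /bil mulmxDr mulmxDl mxE. Qed.

Lemma bilNm n (M : 'M[R]_n) u v : bil (- M) u v = - bil M u v.
Proof. by rewrite /bil mulmxN mulNmx mxE. Qed.

Lemma bilZm n a (M : 'M[R]_n) u v : bil (a *: M) u v = a * bil M u v.
Proof. by rewrite /bil -scalemxAr -scalemxAl mxE. Qed.

Lemma bil_scalar n a (u v : 'cV[R]_n) : bil a%:M u v = a * dot u v.
Proof. by rewrite bil_dot mul_scalar_mx dotZr. Qed.

Lemma bil_outer n (a b u v : 'cV[R]_n) :
  bil (a *m b^T) u v = dot u a * dot b v.
Proof. by rewrite /bil mulmxA -mulmxA mxE big_ord1. Qed.

Lemma bil_delta n (M : 'M[R]_n) i j :
  bil M (delta_mx i 0) (delta_mx j 0) = M i j.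
Proof. by rewrite /bil trmx_delta -rowE -colE !mxE. Qed.

(** For [s = bil M u v / bil M u u] the vector [v - s *: u] is the projection of
[v] orthogonal to [u] for the form [M]; the identity serves to exploit
positivity at such vectors. *)
Lemma bil_subZ n (M : 'M[R]_n) u v s : M^T = M ->
  bil M (v - s *: u) (v - s *: u)
  = bil M v v - 2 * s * bil M u v + s ^+ 2 * bil M u u.
Proof.
move=> MT; have -> : bil M (v - s *: u) (v - s *: u) =
    bil M v v - s * bil M v u - s * bil M u v + s ^+ 2 * bil M u u.
  rewrite /bil [(v - _)^T]linearB /= [trmx (s *: u)]linearZ /=.
  rewrite mulmxBr !mulmxBl -!scalemxAl -!scalemxAr.
  by rewrite !mxE; ring.
by rewrite (bilC v u MT); ring.
Qed.

Lemma dot_subZ n (u v : 'cV[R]_n) s :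
  dot (v - s *: u) (v - s *: u) = dot v v - 2 * s * dot u v + s ^+ 2 * dot u u.
Proof.
by have := bil_subZ u v s (tr_scalar_mx n (1 : R)); rewrite !bil_scalar !mul1r.
Qed.

Lemma bil_block n (X : 'M[R]_n) (x w : 'cV[R]_n) a :
  bil (block_mx 1%:M x^T x X) (col_mx a%:M w) (col_mx a%:M w)
  = a ^+ 2 + 2 * a * dot x w + bil X w w.
Proof.
rewrite /bil tr_col_mx mul_row_block mul_row_col !mulmxDl mulmx1.
rewrite tr_scalar_mx -!mulmxA -scalar_mxM !mul_scalar_mx.
rewrite mul_mx_scalar -scalemxAr.
have -> : w^T *m x = x^T *m w.
  by apply/matrixP => i j; rewrite !ord1; apply: dotC.
by rewrite /dot !mxE eqxx mulr1n; ring.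
Qed.

Lemma dot_ge0 n (v : 'cV[R]_n) : 0 <= dot v v.
Proof. by rewrite dotE sumr_ge0 // => i _; rewrite -expr2 sqr_ge0. Qed.

Lemma sqr_entry_le_dot n (v : 'cV[R]_n) i : v i 0 ^+ 2 <= dot v v.
Proof.
rewrite dotE (bigD1 i) //= -expr2 lerDl sumr_ge0 // => j _.
by rewrite -expr2 sqr_ge0.
Qed.

Lemma dot_gt0 n (v : 'cV[R]_n) : v != 0 -> 0 < dot v v.
Proof.
move=> v0; rewrite lt_neqAle dot_ge0 andbT eq_sym.
apply: contra v0 => /eqP vv; apply/eqP/matrixP => i j.
rewrite (ord1 j) mxE; apply/eqP; rewrite -sqrf_eq0 eq_le sqr_ge0 andbT.
by rewrite -vv sqr_entry_le_dot.
Qed.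

End BilinearForms.

(** * Symmetric and positive semidefinite matrices *)

Section Spectral.
Variable R : realType.

(** The constant is one more than the sum of the absolute values of the entries,
because [`|v i * v j|] never exceeds [dot v v]; the one keeps it positive. *)
Lemma bil_bounded n (M : 'M[R]_n) :
  exists2 K, 0 < K & forall v, bil M v v <= K * dot v v.
Proof.
have S0 : 0 <= \sum_i \sum_j `|M i j| by do 2!apply: sumr_ge0 => ? _.
exists (1 + \sum_i \sum_j `|M i j|); first lra.
move=> v; rewrite mulrDl mul1r; apply: ler_wpDl; first exact: dot_ge0.
rewrite bilE mulr_suml; apply: ler_sum => i _.
rewrite mulr_suml; apply: ler_sum => j _.
apply: (le_trans (ler_norm _)); rewrite mulrAC normrM mulrC.
apply: ler_wpM2l => //; rewrite ler_norml.
have := sqr_entry_le_dot v i; have := sqr_entry_le_dot v j.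
have := sqr_ge0 (v i 0 - v j 0); have := sqr_ge0 (v i 0 + v j 0).
by move: (v i 0) (v j 0) (dot v v) => a b q; nra.
Qed.

(** If [K] bounds the form of [invmx M], then positivity of [M] at
[v - K^-1 *: (invmx M *m v)] reads
[bil M v v >= 2 / K * dot v v - K^-2 * bil (invmx M) v v >= dot v v / K].
This yields a spectral gap without diagonalizing [M]. *)
Lemma pos_def_of_unit n (M : 'M[R]_n) :
    M^T = M -> (forall v, 0 <= bil M v v) -> M \in unitmx ->
  exists2 eps, 0 < eps & forall v, eps * dot v v <= bil M v v.
Proof.
move=> MT M0 Mu; have [K K0 KP] := bil_bounded (invmx M).
exists K^-1; first by rewrite invr_gt0.
move=> v; have := M0 (v - K^-1 *: (invmx M *m v)).
rewrite bil_subZ // (bilC _ v MT) [bil M v (_ *m _)]bil_dot.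
rewrite [bil M (_ *m _) _]bil_dot mulmxA mulmxV // mul1mx.
rewrite [dot _ v in X in _ + X]dotC -[dot v (invmx M *m v)]bil_dot => h.
have : K^-1 ^+ 2 * bil (invmx M) v v <= K^-1 * dot v v.
  rewrite expr2 -mulrA ler_pM2l ?invr_gt0 //.
  by rewrite ler_pdivrMl.
lra.
Qed.

(** Take [mu] to be the infimum of the [s] for which [s I - S] is positive
semidefinite. If [mu I - S] were invertible it would be bounded below by a
positive multiple of the identity, and [mu] could be decreased; hence it is
singular, and its kernel consists of eigenvectors. *)
Lemma largest_eigenvalue n (S : 'M[R]_n) : (0 < n)%N -> S^T = S ->
  exists mu (z : 'cV[R]_n), [/\ z != 0, S *m z = mu *: z
                 & forall v, bil S v v <= mu * dot v v].
Proof.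
case: n S => // n S _ ST.
pose B := [set s : R | forall v, bil S v v <= s * dot v v]%classic.
have Blb : has_lbound B.
  exists (S 0 0) => s /(_ (delta_mx 0 0)).
  suff dd : dot (delta_mx 0 0 : 'cV[R]_n.+1) (delta_mx 0 0) = 1.
    by rewrite bil_delta dd mulr1.
  by rewrite /dot trmx_delta mul_delta_mx mxE !eqxx.
have B0 : (B !=set0)%classic by have [K _ KP] := bil_bounded S; exists K.
pose mu := inf B.
have muP v : bil S v v <= mu * dot v v.
  have [->|v0] := eqVneq v 0; first by rewrite bil_dot mulmx0 !dot0r mulr0.
  rewrite -ler_pdivrMr ?dot_gt0 //; apply: lb_le_inf => // s sB.
  by rewrite ler_pdivrMr ?dot_gt0.
pose M := mu%:M - S.
have MT : M^T = M by rewrite /M linearB /= tr_scalar_mx ST.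
have bilM v : bil M v v = mu * dot v v - bil S v v.
  by rewrite /M bilDm bilNm bil_scalar.
have Mnu : M \notin unitmx.
  apply/negP => Mu; have [|eps eps0 epsP] := pos_def_of_unit MT _ Mu.
    by move=> v; rewrite bilM subr_ge0.
  have : B (mu - eps).
    by move=> v; have := epsP v; rewrite bilM mulrBl; lra.
  by move=> /(ge_inf Blb); rewrite -/mu; lra.
move: Mnu; rewrite -row_free_unit -kermx_eq0 => /rowV0Pn [w].
move=> /sub_kermxP wM w0.
exists mu, w^T; split => //; first by rewrite -[_ == 0]trmx_eq0 trmxK.
apply: (can_inj (@trmxK _ _ _)); move/eqP: wM.
rewrite /M mulmxBr mul_mx_scalar subr_eq0 trmx_mul trmxK ST linearZ /= trmxK.
by move/eqP.
Qed.

(** With a zero diagonal the form is [- 2 * s * X i j] at the [j]-th basis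
vector minus [s] times the [i]-th, and the sign of this value changes with [s]. *)
Lemma psd_zero_diag n (X : 'M[R]_n) :
    X^T = X -> (forall v, 0 <= bil X v v) -> (forall i, X i i = 0) -> X = 0.
Proof.
move=> XT X0 Xd; apply/matrixP => i j; rewrite mxE.
have h s : 0 <= - 2 * s * X i j.
  have := X0 (delta_mx j 0 - s *: delta_mx i 0).
  by rewrite bil_subZ // !bil_delta !Xd; lra.
by have := h 1; have := h (-1); lra.
Qed.

Lemma mxdot_outer n (M : 'M[R]_n) u : mxdot M (u *m u^T) = bil M u u.
Proof.
by rewrite /mxdot mulmxA mxtrace_mulC mulmxA /mxtrace big_ord1.
Qed.

Lemma mxdotC n (M X : 'M[R]_n) : mxdot M X = mxdot X M.
Proof. exact: mxtrace_mulC. Qed.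

Lemma mxdotDr n (M X Y : 'M[R]_n) : mxdot M (X + Y) = mxdot M X + mxdot M Y.
Proof. by rewrite /mxdot mulmxDr linearD. Qed.

Lemma mxdotNr n (M X : 'M[R]_n) : mxdot M (- X) = - mxdot M X.
Proof. by rewrite /mxdot mulmxN linearN. Qed.

Lemma mxdotZr n a (M X : 'M[R]_n) : mxdot M (a *: X) = a * mxdot M X.
Proof. by rewrite /mxdot -scalemxAr linearZ. Qed.

(** [X] is a sum of matrices [u *m u^T] with nonnegative coefficients, and each
contributes [bil M u u]. The decomposition is symmetric Gaussian elimination:
subtracting the rank one matrix spanned by a column with nonzero pivot [X i i]
keeps [X] positive semidefinite, clears the [i]-th diagonal entry and creates no
new nonzero one, so the number of nonzero diagonal entries decreases. *)
Lemma mxdot_psd_ge0 n (M X : 'M[R]_n) :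
    (forall v, 0 <= bil M v v) -> X^T = X -> (forall v, 0 <= bil X v v) ->
  0 <= mxdot M X.
Proof.
move=> M0; have [k] := ubnP #|[set i | X i i != 0]|.
elim: k X => // k IHk X Xk XT X0.
have [i Xii|Xd] := pickP (fun i => X i i != 0); last first.
  rewrite (psd_zero_diag XT X0) /mxdot ?mulmx0 ?mxtrace0 // => i.
  by apply/eqP; have := Xd i; case: eqP.
pose u := X *m delta_mx i 0 : 'cV_n.
pose Y := X - (X i i)^-1 *: (u *m u^T).
have Xi0 : 0 < X i i by rewrite lt_neqAle eq_sym Xii -[X i i]bil_delta X0.
(* The form of the Schur complement is that of X at a projected vector. *)
have bilY v : bil Y v v
    = bil X (v - (bil X (delta_mx i 0) v / X i i) *: delta_mx i 0)
            (v - (bil X (delta_mx i 0) v / X i i) *: delta_mx i 0).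
  rewrite bil_subZ // bil_delta /Y bilDm bilNm bilZm bil_outer.
  by rewrite [dot u v]dotC -bil_dot (bilC v _ XT); field.
have Y0 v : 0 <= bil Y v v by rewrite bilY.
have Yjj j : Y j j = X j j - X i j ^+ 2 / X i i.
  by rewrite -[Y j j]bil_delta bilY bil_subZ // !bil_delta; field.
have XY : X = Y + (X i i)^-1 *: (u *m u^T) by rewrite /Y subrK.
rewrite [X in mxdot M X]XY mxdotDr mxdotZr mxdot_outer addr_ge0 //; last first.
  by rewrite mulr_ge0 // invr_ge0 ltW.
apply: IHk => //; last first.
  by rewrite /Y linearB linearZ /= trmx_mul trmxK XT.
apply: leq_trans (Xk : (_ <= k)%N).
apply: proper_card; apply/properP; split; last first.
  exists i; rewrite !inE ?Xii //.
  by rewrite Yjj negbK expr2 mulfK // subrr.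
apply/fintype.subsetP => j; rewrite !inE; apply: contra => /eqP Xj0.
rewrite eq_le -{2}[Y j j]bil_delta Y0 andbT Yjj Xj0 sub0r oppr_le0.
by rewrite divr_ge0 ?sqr_ge0 // ltW.
Qed.

End Spectral.

(** * Matrices of a regular balanced bipartite graph *)

Section Graph.
Variables (R : realType) (V : finType) (G : bigraph V).

Notation n := (#|V|%:R : R).
Notation A := (adjmx R G).
Notation C := (crossmx R G).
Notation f := (sidevec R G).
Notation e := (const_mx 1 : 'cV[R]_#|V|).

Lemma adjmx_sym : A^T = A.
Proof. by apply/matrixP => i j; rewrite !mxE adj_sym. Qed.

Lemma in_part2 v : (v \in part2 G) = (v \notin part1 G).
Proof.
have := finset.in_setT v; rewrite -(part_cover G) inE.
have [v1 _|_ /= -> //] := boolP (v \in part1 G).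
by rewrite (disjointFr (part_disjoint G) v1).
Qed.

Lemma sidevec_sqr i : f i 0 * f i 0 = 1.
Proof. by rewrite !mxE in_part2; case: (_ \in _) => /=; ring. Qed.

Lemma adjmx_sidevec i j : A i j * f j 0 = - (f i 0 * A i j).
Proof.
rewrite !mxE; have [/adj_bip|_] := boolP (adj G _ _); last by rewrite /=; ring.
by rewrite !in_part2; do 2![case: (_ \in part1 G)] => //= _; ring.
Qed.

Lemma crossmxE : C = 4^-1 *: (e *m e^T - f *m f^T).
Proof.
apply/matrixP => i j; rewrite !mxE !big_ord1 !mxE !in_part2.
by do 2![case: (_ \in part1 G)] => /=; field.
Qed.

Lemma const_mx_outer : const_mx 1 = e *m e^T.
Proof. by apply/matrixP => i j; rewrite !mxE big_ord1 !mxE mulr1. Qed.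

Lemma dot_ones : dot e e = n.
Proof.
rewrite dotE (eq_bigr (fun=> 1)) => [|i _]; last by rewrite !mxE mulr1.
by rewrite sumr_const card_ord.
Qed.

Lemma dot_side : dot f f = n.
Proof.
rewrite dotE (eq_bigr (fun=> 1)) => [|i _]; last exact: sidevec_sqr.
by rewrite sumr_const card_ord.
Qed.

Lemma sum_enum_val (F : V -> R) : \sum_(i < #|V|) F (enum_val i) = \sum_v F v.
Proof.
rewrite [RHS](reindex (@enum_val V predT)) //.
by apply: onW_bij; apply: enum_val_bij.
Qed.

Lemma dot_ones_side : #|part1 G| = #|part2 G| -> dot e f = 0.
Proof.
move=> bal; rewrite dotE.
under eq_bigr do rewrite !mxE mul1r.
rewrite (sum_enum_val (fun v => (v \in part1 G)%:R - (v \in part2 G)%:R)).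
rewrite sumrB -!natr_sum -!big_mkcond /= !sum1_card bal subrr //.
Qed.

Lemma diag_side_ones : diag_mx f^T *m e = f.
Proof.
by apply/matrixP => i j; rewrite mul_diag_mx !mxE mulr1.
Qed.

Lemma diag_side_adjmx : diag_mx f^T *m A = - (A *m diag_mx f^T).
Proof.
apply/matrixP => i j; have := adjmx_sidevec i j.
by rewrite mul_diag_mx mul_mx_diag !mxE => ->; rewrite opprK.
Qed.

(** * Optimal solutions of the dual and primal programs *)

Section Regular.
Variable d : nat.
Hypothesis reg : forall v : V, #|[set w | adj G v w]| = d.

Lemma adjmx_ones : A *m e = d%:R *: e.
Proof.
apply/matrixP => i j; rewrite !mxE mulr1 -(reg (enum_val i)).
under eq_bigr do rewrite !mxE mulr1.
rewrite (sum_enum_val (fun w => (adj G (enum_val i) w)%:R)) -natr_sum.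
by rewrite -big_mkcond /= sum1dep_card cardsE.
Qed.

(** Multiplication by the diagonal matrix of [f] anticommutes with [A] and maps
[e] to [f], so it negates the eigenvalue of [e]. *)
Lemma adjmx_side : A *m f = - d%:R *: f.
Proof.
have -> : f = diag_mx f^T *m e by rewrite diag_side_ones.
rewrite scaleNr scalemxAr -adjmx_ones !mulmxA diag_side_adjmx.
by rewrite mulNmx opprK.
Qed.

Hypothesis bal : #|part1 G| = #|part2 G|.
Hypothesis V0 : (0 < #|V|)%N.

Let n0 : 0 < n. Proof. by rewrite ltr0n. Qed.

(** The matrix [- A] with its eigenvectors [e] and [f] moved to the eigenvalue
zero. *)
Definition deflated : 'M[R]_#|V| :=
  (d%:R / n) *: (e *m e^T - f *m f^T) - A.

Lemma bil_deflated u v :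
  bil deflated u v
  = d%:R / n * (dot u e * dot e v - dot u f * dot f v) - bil A u v.
Proof. by rewrite /deflated bilDm bilNm bilZm bilDm bilNm !bil_outer. Qed.

Lemma deflated_sym : deflated^T = deflated.
Proof.
rewrite /deflated linearB linearZ /= linearB /= !trmx_mul !trmxK.
by rewrite adjmx_sym.
Qed.

Lemma bil_deflated_ones v : bil deflated e v = 0.
Proof.
rewrite bil_deflated dot_ones dot_ones_side // bil_dotl ?adjmx_sym //.
by rewrite adjmx_ones dotZl; field; rewrite gt_eqF.
Qed.

Lemma bil_deflated_side v : bil deflated f v = 0.
Proof.
rewrite bil_deflated dot_side dotC dot_ones_side // bil_dotl ?adjmx_sym //.
by rewrite adjmx_side dotZl; field; rewrite gt_eqF.
Qed.

Lemma crossmx_sym : C^T = C.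
Proof. by rewrite crossmxE linearZ /= linearB /= !trmx_mul !trmxK. Qed.

Lemma bil_dual lam t v : bil (lam%:M + t *: A - C) v v
  = lam * dot v v + t * bil A v v
    - 4^-1 * (dot e v ^+ 2 - dot f v ^+ 2).
Proof.
rewrite bilDm bilDm bilNm bil_scalar bilZm crossmxE bilZm bilDm bilNm.
by rewrite !bil_outer (dotC v e) (dotC v f); ring.
Qed.

(** The relation between [lam] and [t] gives
[lam I + t A - C = lam (I - e e^T / n) + (lam / n) f f^T - t N] with [N] the
deflated matrix. As [N] kills [e], its form at [v] is the one at the projection
[w] of [v] orthogonal to [e], where it is at most [mu * dot w w], while
[I - e e^T / n] contributes exactly [dot w w]. *)
Lemma dual_feasible mu lam t :
    (forall v, bil deflated v v <= mu * dot v v) ->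
    0 <= t -> t * mu <= lam -> lam = n / 4 - t * d%:R -> 0 <= lam ->
  psd (lam%:M + t *: A - C).
Proof.
move=> muP t0 tmu lamE lam0; split.
  apply/symmetricmxE.
  by rewrite linearB linearD linearZ /= tr_scalar_mx adjmx_sym crossmx_sym.
move=> v; rewrite -/(bil _ v v) bil_dual.
pose p := dot e v; pose r := dot f v; rewrite -/p -/r.
pose w := v - (p / n) *: e.
have ww : dot w w = dot v v - p ^+ 2 / n.
  by rewrite dot_subZ dot_ones -/p; field; rewrite gt_eqF.
have Nw : bil deflated w w = bil deflated v v.
  rewrite bil_subZ ?deflated_sym // !bil_deflated_ones; ring.
have := muP w; rewrite Nw => /(ler_wpM2l t0).
have := ler_wpM2r (dot_ge0 w) tmu; rewrite mulrA => le1 le2.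
have := le_trans le2 le1.
rewrite ww bil_deflated (dotC v e) (dotC v f) -/p -/r.
have rr : 0 <= lam / n * r ^+ 2 by rewrite mulr_ge0 ?sqr_ge0 // divr_ge0 // ltW.
move=> h; rewrite -subr_ge0 in h; apply: le_trans (addr_ge0 h rr) _.
rewrite le_eqVlt; apply/orP; left; apply/eqP.
by rewrite lamE; field; rewrite gt_eqF.
Qed.

(** The candidate is [X = c ^+ 2 e e^T + g z z^T] bordered by [x = c e]: the
form of the bordered matrix at [(a, w)] is
[(a + c (e^T w)) ^+ 2 + g (z^T w) ^+ 2]. The numerical hypotheses are
orthogonality to [Diag f], orthogonality to [A], and equality of the trace with
[e^T x]. *)
Lemma primal_feasible c g (z : 'cV[R]_#|V|) :
    dot e z = 0 -> dot f z = 0 -> 0 <= g ->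
    g * bil (diag_mx f^T) z z = 0 ->
    c ^+ 2 * n * d%:R + g * bil A z z = 0 ->
    n * c = n * c ^+ 2 + g * dot z z ->
  exists X x, [/\ lasserre_feasible G X x, \tr X = n * c
                & mxdot (const_mx 1) X = (n * c) ^+ 2].
Proof.
move=> ez fz g0 Dz Az trE.
pose X := c ^+ 2 *: (e *m e^T) + g *: (z *m z^T).
have mxdotX M : mxdot M X = c ^+ 2 * bil M e e + g * bil M z z.
  by rewrite mxdotDr !mxdotZr !mxdot_outer.
have XT : X^T = X by rewrite linearD !linearZ /= !trmx_mul !trmxK.
have trX : \tr X = n * c.
  rewrite -[X in \tr X]mul1mx -/(mxdot _ _) mxdotX.
  by rewrite !bil_scalar dot_ones trE; ring.
exists X, (c *: e); split => //; last first.
  by rewrite mxdotX const_mx_outer !bil_outer ez dot_ones; ring.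
split.
- exact/symmetricmxE.
- split.
    by apply/symmetricmxE; rewrite tr_block_mx trmxK XT tr_scalar_mx.
  move=> v; rewrite -/(bil _ v v) -[v]vsubmxK [usubmx v]mx11_scalar.
  move: (usubmx v 0 0) (dsubmx v) => a w.
  rewrite bil_block dotZl bilDm !bilZm !bil_outer (dotC w e) (dotC w z).
  have := mulr_ge0 g0 (sqr_ge0 (dot z w)); have := sqr_ge0 (a + c * dot e w).
  lra.
- by rewrite trX -[RHS]/(dot _ _) dotZr dot_ones mulrC.
- split.
  + by rewrite mxdotX bil_dot (adjmx_ones) dotZr dot_ones -[RHS]Az; ring.
  + rewrite mxdotC mxdot_outer bilDm !bilZm !bil_outer (dotC z f) fz.
    by rewrite (dotC f e) dot_ones_side //; ring.
  + by rewrite mxdotX bil_dot diag_side_ones dot_ones_side // Dz; ring.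
Qed.

(** The pair satisfies complementary slackness: the trace equality
[4 * lam] together with [<J, X> = 16 * lam ^+ 2] turns weak duality into an
equality. *)
Lemma optimal_pair : exists lam t X x,
  [/\ psd (lam%:M + t *: A - C), lasserre_feasible G X x,
      \tr X = 4 * lam & mxdot (const_mx 1) X = 16 * lam ^+ 2].
Proof.
have [mu [z [z0 Nz muP]]] := largest_eigenvalue V0 deflated_sym.
have mu0 : 0 <= mu.
  by have := muP e; rewrite bil_deflated_ones dot_ones pmulr_lge0.
have [d0|dn0] := eqVneq d 0%N.
  exists (n / 4), 0.
  have [||||||X [x [lasX trX JX]]] := @primal_feasible 1 0 0.
  - by rewrite dot0r.
  - by rewrite dot0r.
  - by [].
  - by rewrite mul0r.
  - by rewrite d0; ring.
  - by ring.
  exists X, x; split => //; last 2 first.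
  - by rewrite trX; field.
  - by rewrite JX; field.
  apply: (dual_feasible muP) => //; first by rewrite mul0r divr_ge0 // ltW.
  - by rewrite mul0r subr0.
  - by rewrite divr_ge0 // ltW.
have d0 : 0 < d%:R :> R by rewrite ltr0n lt0n.
have s0 : 0 < d%:R + mu by lra.
(* At this t the constraint lam = n / 4 - t d meets t mu <= lam with equality,
   which makes lam as small as possible. *)
pose t := n / (4 * (d%:R + mu)).
have t0 : 0 <= t by rewrite divr_ge0 ?mulr_ge0 // ltW.
exists (t * mu), t.
have dual : psd ((t * mu)%:M + t *: A - C).
  apply: (dual_feasible muP) => //; last by rewrite mulr_ge0.
  by rewrite /t; field; rewrite gt_eqF.
have [mu00|mun0] := eqVneq mu 0.
  have [||||||X [x [lasX trX JX]]] := @primal_feasible 0 0 0.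
  - by rewrite dot0r.
  - by rewrite dot0r.
  - by [].
  - by rewrite mul0r.
  - by ring.
  - by ring.
  exists X, x; split => //; first by rewrite trX mu00; ring.
  by rewrite JX mu00; ring.
have mu_gt0 : 0 < mu by rewrite lt_neqAle eq_sym mun0.
have perp u : bil deflated u z = 0 -> dot u z = 0.
  by rewrite bil_dot Nz dotZr => /eqP; rewrite mulf_eq0 (negPf mun0) => /eqP.
have ez := perp _ (bil_deflated_ones z).
have fz := perp _ (bil_deflated_side z).
have Az : A *m z = - mu *: z.
  rewrite scaleNr -Nz /deflated mulmxBl -scalemxAl mulmxBl -!mulmxA.
  have -> : e^T *m z = 0 by apply/matrixP => i j; rewrite !ord1 [LHS]ez mxE.
  have -> : f^T *m z = 0 by apply/matrixP => i j; rewrite !ord1 [LHS]fz mxE.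
  by rewrite !mulmx0 subrr scaler0 sub0r opprK.
(* Diag f maps the eigenspace of - mu to that of mu, which is orthogonal. *)
have Dz : bil (diag_mx f^T) z z = 0.
  have : dot z (diag_mx f^T *m A *m z) = - mu * bil (diag_mx f^T) z z.
    by rewrite -mulmxA Az -scalemxAr dotZr bil_dot.
  rewrite diag_side_adjmx mulNmx -scaleN1r dotZr -mulmxA -bil_dot.
  rewrite bil_dotl ?adjmx_sym // Az dotZl -bil_dot => h.
  have /eqP : mu * bil (diag_mx f^T) z z = 0 by lra.
  by rewrite mulf_eq0 (negPf mun0) => /eqP.
have zz := dot_gt0 z0.
(* Forced by the trace equality for c = mu / (d + mu), that is n c = 4 lam. *)
pose g := n * mu * d%:R / ((d%:R + mu) ^+ 2 * dot z z).
have [||||||X [x [lasX trX JX]]] :=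
  @primal_feasible (mu / (d%:R + mu)) g z => //.
- by rewrite divr_ge0 ?mulr_ge0 ?sqr_ge0 // ltW.
- by rewrite Dz mulr0.
- by rewrite bil_dot Az dotZr /g; field; rewrite !gt_eqF.
- by rewrite /g; field; rewrite !gt_eqF.
exists X, x; split => //.
- by rewrite trX /t; field; rewrite gt_eqF.
- by rewrite JX /t; field; rewrite gt_eqF.
Qed.


End Regular.

(** * Weak duality and the four values *)

(** The diagonals of [A] and [C] vanish, so [lam] is a diagonal entry of a
positive semidefinite matrix. *)
Lemma dual_lam_ge0 lam t :
  (0 < #|V|)%N -> psd (lam%:M + t *: A - C) -> 0 <= lam.
Proof.
move=> V0 [_ /(_ (delta_mx (Ordinal V0) 0))]; rewrite -/(bil _ _ _) bil_delta.
rewrite !mxE eqxx mulr1n adj_irr in_part2.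
by case: (_ \in part1 G); rewrite /= mulr0 addr0 subr0.
Qed.

Lemma crossmx_mxdot (X : 'M[R]_#|V|) : balanced_constraints G X ->
  mxdot C X = 4^-1 * mxdot (const_mx 1) X.
Proof.
case=> _ fX _; rewrite mxdotC crossmxE mxdotZr mxdotDr mxdotNr.
by rewrite ![mxdot X _]mxdotC fX subr0 const_mx_outer.
Qed.

Lemma weak_duality lam t (X : 'M[R]_#|V|) :
    psd (lam%:M + t *: A - C) -> psd X -> balanced_constraints G X ->
  4^-1 * mxdot (const_mx 1) X <= lam * \tr X.
Proof.
move=> [_ dual] [/symmetricmxE XT X0] balX.
have := mxdot_psd_ge0 dual XT X0; rewrite mxdotC mxdotDr mxdotDr mxdotNr.
rewrite -scalemx1 !mxdotZr ![mxdot X _]mxdotC crossmx_mxdot //.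
by case: balX => -> _ _; rewrite /mxdot mul1mx; lra.
Qed.

Lemma lasserre_psd (X : 'M[R]_#|V|) x : lasserre_feasible G X x -> psd X.
Proof.
case=> symX [_ pX] _ _; split=> // v.
have := pX (col_mx 0%:M v); rewrite -/(bil _ _ _) bil_block.
by rewrite expr0n mulr0 mul0r !add0r.
Qed.

(** The bordered matrix evaluated at [(- e^T x, e)] gives
[<J, X> - (e^T x) ^+ 2 >= 0]. *)
Lemma lasserre_tr_sqr (X : 'M[R]_#|V|) x : lasserre_feasible G X x ->
  \tr X ^+ 2 <= mxdot (const_mx 1) X.
Proof.
case=> _ [_ pX] -> _; rewrite -/(dot e x).
have := pX (col_mx (- dot e x)%:M e); rewrite -/(bil _ _ _) bil_block.
by rewrite (dotC x) mxdotC const_mx_outer mxdot_outer; lra.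
Qed.

End Graph.

Theorem proposition6p8 (R : realType) (V : finType) (G : bigraph V)
    (V_nonempty : (0 < #|V|)%N)
    (G_regular : regular G)
    (G_balanced : #|part1 G| = #|part2 G|) :
  exists las g theta h : R,
    [/\ is_las_bal_hat G las, is_g_bal_hat G g, is_theta_bal_hat G theta
      & is_h_hat G h] /\
    [/\ 4^-1 * las = 2^-1 * Num.sqrt g,
        2^-1 * Num.sqrt g = 4^-1 * theta
      & 4^-1 * theta = h].
Proof.
have [d reg] := G_regular.
have [lam [t [X [x [dual lasX trX JX]]]]] :=
  optimal_pair R reg G_balanced V_nonempty.
have lam0 := dual_lam_ge0 V_nonempty dual.
have psdX := lasserre_psd lasX.
have balX : balanced_constraints G X by case: lasX.
have tr_le Y y : lasserre_feasible G Y y -> \tr Y <= 4 * lam.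
  move=> lasY; have balY : balanced_constraints G Y by case: lasY.
  have := weak_duality dual (lasserre_psd lasY) balY.
  have := lasserre_tr_sqr lasY.
  by move: (\tr Y) (mxdot _ _) => T j; nra.
exists (4 * lam), (4 * lam ^+ 2), (4 * lam), lam; split; last first.
  have -> : 4 * lam ^+ 2 = (2 * lam) ^+ 2 by ring.
  by rewrite sqrtr_sqr ger0_norm ?mulr_ge0 //; split; field.
split.
- left; split; first by exists X, x; rewrite /mxdot mul1mx trX.
  by move=> _ [Y [y [lasY ->]]]; rewrite /mxdot mul1mx (tr_le _ _ lasY).
- left; split.
    by exists X, x; split=> //; rewrite crossmx_mxdot // JX; field.
  move=> _ [Y [y [lasY ->]]].
  have balY : balanced_constraints G Y by case: lasY.
  rewrite crossmx_mxdot //.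
  apply: (le_trans (weak_duality dual (lasserre_psd lasY) balY)).
  by rewrite expr2 mulrCA ler_wpM2l // (tr_le _ _ lasY).
- have theta_le Y : theta_feasible G Y -> mxdot (const_mx 1) Y <= 4 * lam.
    case=> _ pY trY balY.
    by have := weak_duality dual pY balY; rewrite trY; lra.
  (* If lam = 0, the matrix X may vanish and cannot be normalized; but then any
     feasible point has value 0, by positivity and the upper bound. *)
  have [lam00|lamn0] := eqVneq lam 0.
    have [[Y Yfeas]|infeas] := pselect (exists Y, theta_feasible (R := R) G Y).
      left; split; last by move=> _ [Z [Zfeas ->]]; apply: theta_le.
      exists Y; split=> //; apply/eqP; rewrite eq_le theta_le // andbT.
      case: Yfeas => _ [_ pY] _ _.
      by rewrite lam00 mulr0 mxdotC const_mx_outer mxdot_outer pY.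
    right; split; last by rewrite lam00 mulr0.
    by rewrite -subset0 => y [Y [Yfeas _]]; apply: infeas; exists Y.
  left; split; last by move=> _ [Z [Zfeas ->]]; apply: theta_le.
  exists ((4 * lam)^-1 *: X); split; last by rewrite mxdotZr JX; field.
  have /symmetricmxE XT : X \is symmetricmx by case: psdX.
  have symY : (4 * lam)^-1 *: X \is symmetricmx.
    by apply/symmetricmxE; rewrite linearZ /= XT.
  case: balX => AX fX DX; split=> //.
  + split=> // v; rewrite -/(bil _ v v) bilZm mulr_ge0 //.
      by rewrite invr_ge0 mulr_ge0.
    by case: psdX => _; apply.
  + by rewrite linearZ /= trX mulVf // mulf_neq0 ?pnatr_eq0.
  + by split; rewrite mxdotZr ?AX ?fX ?DX mulr0.
- split; first by exists t.
  move=> lam' [t' dual'].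
  have [->|lamn0] := eqVneq lam 0; first exact: dual_lam_ge0 dual'.
  have lam_gt0 : 0 < lam by rewrite lt_neqAle eq_sym lamn0.
  (* Testing the competitor against X gives 4 lam ^ 2 <= 4 lam lam'. *)
  have := weak_duality dual' psdX balX; rewrite trX JX => h.
  rewrite -(ler_pM2r lam_gt0); lra.
Qed.
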